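(* For $x \in \mathbb{C}$, $l \in \mathbb{N}_0$ and $n\in\mathbb{N}_0$, $$\sum_{k=1}^n k^3 H_k^{(l+4)}(x) = \frac{(n-x)(x+n+1)(x^2+x+n+n^2)}{4} H_n^{(l+4)}(x) + \frac{x(x+1)(2x+1)}{2} H_n^{(l+3)}(x) - \frac{6x^2+6x+1}{4} H_n^{(l+2)}(x) + \frac{2x+1}{2} H_n^{(l+1)}(x) - \frac{H_n^{(l)}(x)}{4}.$$
   Context: For $x\in\mathbb{C}$ and $l,n\in\mathbb{N}_0$, $H_0^{(l)}(x)=0$ and $H_n^{(l)}(x)=\sum_{k=1}^n \frac{1}{(x+k)^l}$ for $n\ge 1$ (defined whenever $x$ is not one of $-1,\dots,-n$). In particular $H_n^{(0)}(x)=n$. *)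

(* Defs.v *)
From mathcomp Require Import all_boot all_order all_algebra.
From mathcomp Require Import complex reals.

Set Implicit Arguments.
Unset Strict Implicit.
Unset Printing Implicit Defensive.

Import GRing.Theory.
Local Open Scope ring_scope.

(* H_n^{(l)}(x); meaningful only when x is none of -1, ..., -n (the
   inverse of 0 is 0 by convention). For n = 0 the sum is empty, so the value is 0. *)
Definition gharmonic (R : realType) (l n : nat) (x : R[i]) : R[i] :=
  \sum_(1 <= k < n.+1) 1 / (x + k%:R) ^+ l.

(* Main.v *)
(* Induction on n. As
     (n - x)(x + n + 1)(x^2 + x + n + n^2) = n^2 (n + 1)^2 - x^2 (x + 1)^2,
   the coefficient of H_n^{(l+4)} increases by (n + 1)^3 at each step, and the
   other coefficients are the opposites of those of its expansion in powers of
   y = x + n + 1. *)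

Require Import Defs.
From mathcomp Require Import all_boot all_order all_algebra.
From mathcomp Require Import complex reals ring.

Set Implicit Arguments.
Unset Strict Implicit.
Unset Printing Implicit Defensive.

Import GRing.Theory.
Local Open Scope ring_scope.

Lemma gharmonicS (R : realType) (l n : nat) (x : R[i]) :
  gharmonic l n.+1 x = gharmonic l n x + 1 / (x + n.+1%:R) ^+ l.
Proof. by rewrite /gharmonic big_nat_recr. Qed.

Theorem theorem19 (R : realType) (x : R[i]) (l n : nat)
    (hx : forall k : nat, (1 <= k <= n)%N -> x <> - k%:R) :
  \sum_(1 <= k < n.+1) k%:R ^+ 3 * gharmonic (l + 4) k x =
    (n%:R - x) * (x + n%:R + 1) * (x ^+ 2 + x + n%:R + n%:R ^+ 2) / 4%:R
      * gharmonic (l + 4) n x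
    + x * (x + 1) * (2%:R * x + 1) / 2%:R * gharmonic (l + 3) n x
    - (6%:R * x ^+ 2 + 6%:R * x + 1) / 4%:R * gharmonic (l + 2) n x
    + (2%:R * x + 1) / 2%:R * gharmonic (l + 1) n x
    - gharmonic l n x / 4%:R.
Proof.
elim: n hx => [|n IHn] hx.
  by rewrite /gharmonic !big_geq // !mulr0 mul0r !addr0 !subr0.
(* The only new denominator is y = x + n + 1, nonzero by [hx] at [k = n + 1]. *)
have y_neq0 : x + n.+1%:R != 0.
  by rewrite addr_eq0; apply/eqP; apply: hx; rewrite ltnSn.
rewrite big_nat_recr //= IHn; last first.
  by move=> k /andP[k_gt0 le_kn]; apply: hx; rewrite k_gt0 leqW.
(* [exprD] confines the symbolic exponent to y^l, soon the nonzero atom [yl]; [natr1] makes y a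
   polynomial in [n%:R]. *)
rewrite !gharmonicS !exprD -!natr1 in y_neq0 *.
have yl_neq0 := expf_neq0 l y_neq0.
set yl := (x + (n%:R + 1)) ^+ l in yl_neq0 *.
(* The sums up to n cancel. Times [yl] y^4, what is left is the expansion in y of the coefficient of
   H_n^{(l+4)}; it has no constant term, as y = 0 means n = -x - 1, a root. *)
field.
by rewrite y_neq0 yl_neq0.
Qed.
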